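(* For a permutation $\pi=\pi_1\cdots\pi_n$ of $[n]$, let $G_\pi$ be its grid graph (defined in the context). Let $\mathrm{Av}_n(213)$ be the set of permutations of $[n]$ avoiding the pattern $213$, and for $r\in\{1,2,3,4\}$ let \[ Q_r(n)=\sum_{\pi\in\mathrm{Av}_n(213)}\#\{v\in V(G_\pi):\deg(v)=r\}. \] Write $B_n=\binom{2n}{n}$. Then for all $n\ge 2$, \begin{align*} Q_1(n) &= \frac{n+2}{2(2n-1)}\,B_n,\\ Q_2(n) &= \frac{(12n^2+44n-112)\,B_n+(2n^2+n-1)\,4^n}{16(n+1)(2n-1)},\\ Q_3(n) &= \frac{(8n^2-96n+88)\,B_n+(6n^2+3n-3)\,4^n}{8(n+1)(2n-1)},\\ Q_4(n) &= \frac{(4n^3-7n^2+29n-20)\,B_n}{4(n+1)(2n-1)}-7\cdot 4^{\,n-2}. \end{align*}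
   Context: The grid graph $G_\pi$ of a permutation $\pi=\pi_1\cdots\pi_n$ of $[n]=\{1,\dots,n\}$ has vertex set $V(G_\pi)=\{(i,j):1\le i\le n,\ 1\le j\le \pi_i\}$; two vertices $(i,j),(i',j')$ are adjacent iff either $i=i'$ and $|j-j'|=1$ (vertical edge), or $|i-i'|=1$ and $j=j'$ (horizontal edge). A permutation avoids $213$ if there are no indices $p<q<r$ with $\pi_q<\pi_p<\pi_r$. *)

(* Defs.v *)
From mathcomp Require Import all_boot all_order all_algebra all_fingroup.

Set Implicit Arguments.
Unset Strict Implicit.
Unset Printing Implicit Defensive.

(* Positions and values are shifted down by one: s : 'S_n encodes the
   permutation pi of {1, ..., n} with pi_(i+1) = s i + 1. *)

Definition avoids213 (n : nat) (s : 'S_n) : bool :=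
  ~~ [exists p : 'I_n, exists q : 'I_n, exists r : 'I_n,
        [&& p < q, q < r, s q < s p & s p < s r]].

Definition Av213 (n : nat) : {set 'S_n} := [set s : 'S_n | avoids213 s].

(* The pair (i, j) stands for the vertex (i + 1, j + 1), so the condition
   j + 1 <= pi_(i+1) becomes j <= s i. *)
Definition grid_vertices (n : nat) (s : 'S_n) : {set 'I_n * 'I_n} :=
  [set v : 'I_n * 'I_n | v.2 <= s v.1].

Definition grid_adj (n : nat) : rel ('I_n * 'I_n) := fun v w =>
  (v.1 == w.1) && (`|(v.2 : nat) - (w.2 : nat)|%N == 1)
  || (`|(v.1 : nat) - (w.1 : nat)|%N == 1) && (v.2 == w.2).

Definition grid_degree (n : nat) (s : 'S_n) (v : 'I_n * 'I_n) : nat :=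
  #|[set w in grid_vertices s | grid_adj v w]|.

Definition Q (r n : nat) : nat :=
  \sum_(s in Av213 n) #|[set v in grid_vertices s | grid_degree s v == r]|.

(* Main.v *)
(* A 213-avoiding permutation whose minimum 1 has the words L and R on its left
   and right satisfies L > R entrywise, so the avoiders are exactly the words
   (L + |R| + 1) 1 (R + 1) with L and R smaller avoiders: a Catalan
   decomposition. The number of vertices of degree d is a sum over columns of a
   function of three consecutive heights. Counting all vertices and all edges
   leaves the degrees 1 and 4 to be counted, and everything reduces to column
   sums f that are additive up to a term in |L| and |R|. With c the Catalan
   series, the totals of such an f satisfy F = 2 x c F + x G, so that F = x G b,
   where b = 1 / (1 - 2 x c) is the series of central binomial coefficients. *)

Require Import Defs.
From HB Require Import structures.
From mathcomp Require Import all_boot all_order all_algebra all_fingroup.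
From mathcomp Require Import zify ring.
From mathcomp.classical Require boolp.

(** * Words of 213-avoiding permutations *)

Fixpoint av213 (w : seq nat) : bool :=
  if w is x :: w' then pairwise (fun y z => ~~ (y < x < z)) w' && av213 w' else true.

Lemma av213P w : reflect
  (forall p q r, p < q -> q < r -> r < size w ->
     ~~ (nth 0 w q < nth 0 w p < nth 0 w r))
  (av213 w).
Proof.
elim: w => [|x w IHw] /=; first by apply: ReflectT.
apply: (iffP andP) => [[/(pairwiseP 0) pw /IHw avw] [|p] [|q] [|r] //|avw].
- by move=> _ lt_qr lt_rw; apply: (pw q r) => //; rewrite inE; move: lt_qr lt_rw => /=; lia.
- by move=> ? ? ?; apply: avw.
split; last by apply/IHw => p q r *; apply: (avw p.+1 q.+1 r.+1).
apply/(pairwiseP 0) => q r; rewrite !inE => _ lt_rw lt_qr.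
exact: (avw 0 q.+1 r.+1).
Qed.

Lemma av213_map_add s w : av213 (map (addn s) w) = av213 w.
Proof.
elim: w => //= x w ->; congr andb; rewrite pairwise_map.
by apply: eq_pairwise => y z /=; rewrite !ltn_add2l.
Qed.

(** For [x] in [u] and [z] in [v], the entries [x], [m], [z] form a 213 unless [z <= x]. Once [v]
    lies below [u], no occurrence starts in [u] and ends in [m :: v]. *)
Lemma av213_cat_min m u v : all (ltn m) u ->
  av213 (u ++ m :: v) = [&& av213 u, av213 (m :: v) & allrel geq u v].
Proof.
elim: u => [|x u IHu] /=; first by rewrite allrel0l andbT.
case/andP=> lt_mx lt_mu; rewrite IHu // allrel_consl pairwise_cat /=.
have -> : all (fun z => ~~ (m < x < z)) v = all (geq x) v.
  by apply: eq_all => z; rewrite lt_mx -leqNgt.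
case le_vx : (all (geq x) v); last by rewrite !(andbF, andFb).
have -> : allrel (fun y z => ~~ (y < x < z)) u (m :: v).
  apply/allrelP => y z _; rewrite inE => /predU1P[->|/(allP le_vx)] /=; lia.
have -> : pairwise (fun y z => ~~ (y < x < z)) v.
  move/allP: le_vx => le_vx; apply/(pairwiseP 0) => i j _ lt_jv _.
  have /= := le_vx _ (mem_nth 0 lt_jv); lia.
by rewrite /= !andbT -!andbA.
Qed.

Lemma av213_cons_min m v : all (leq m) v -> av213 (m :: v) = av213 v.
Proof.
move/allP=> le_mv /=; suff -> : pairwise (fun y z => ~~ (y < m < z)) v by [].
apply/(pairwiseP 0) => i j lt_iv _ _.
have /= := le_mv _ (mem_nth 0 lt_iv); lia.
Qed.

(** * The Catalan decomposition of the avoiders *)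

Definition words (n : nat) : seq (seq nat) :=
  [seq w <- permutations (iota 1 n) | av213 w].

Lemma words_uniq n : uniq (words n).
Proof. exact/filter_uniq/permutations_uniq. Qed.

Lemma mem_words n w : (w \in words n) = perm_eq w (iota 1 n) && av213 w.
Proof. by rewrite mem_filter mem_permutations andbC. Qed.

Lemma size_words n w : w \in words n -> size w = n.
Proof. by rewrite mem_words => /andP[/perm_size->]; rewrite size_iota. Qed.

Lemma words_gt0 n w : w \in words n -> all (leq 1) w.
Proof.
rewrite mem_words => /andP[/perm_mem w_iota _]; apply/allP => x.
by rewrite w_iota mem_iota => /andP[].
Qed.

Definition glue (l r : seq nat) : seq nat :=
  map (addn (size r).+1) l ++ 1 :: map (addn 1) r.

Lemma perm_glue l r a b : perm_eq l (iota 1 a) -> perm_eq r (iota 1 b) ->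
  perm_eq (glue l r) (iota 1 (a + b).+1).
Proof.
move=> la rb; rewrite /glue (perm_size rb) size_iota perm_catC /= perm_cons.
have -> : iota 2 (a + b) = map (addn 1) (iota 1 b) ++ map (addn b.+1) (iota 1 a).
  by rewrite -!iotaDl addnC iotaD; congr (_ ++ iota _ _); lia.
by apply: perm_cat; apply: perm_map.
Qed.

Lemma av213_glue l r a : all (leq 1) l -> all (leq 1) r -> perm_eq r (iota 1 a) ->
  av213 (glue l r) = av213 l && av213 r.
Proof.
move=> l1 r1 ra; rewrite av213_cat_min; last first.
  by apply/allP => _ /mapP[x /(allP l1) /= x1 ->] /=; lia.
rewrite av213_cons_min ?av213_map_add; last first.
  by apply/allP => _ /mapP[x /(allP r1) /= x1 ->] /=; lia.
suff -> : allrel geq [seq (size r).+1 + i | i <- l] [seq 1 + i | i <- r].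
  by rewrite andbT.
apply/allrelP => _ _ /mapP[x _ ->] /mapP[y yr ->] /=.
by move: yr; rewrite (perm_mem ra) mem_iota (perm_size ra) size_iota; lia.
Qed.

Lemma mem_glue a b l r : l \in words a -> r \in words b ->
  glue l r \in words (a + b).+1.
Proof.
move=> la rb; have l1 := words_gt0 _ _ la; have r1 := words_gt0 _ _ rb.
move: la rb; rewrite !mem_words => /andP[la avl] /andP[rb avr].
by rewrite perm_glue //= (av213_glue _ _ _ l1 r1 rb) avl.
Qed.

Lemma map_sub_add s w : all (leq s) w -> map (addn s) (map (subn^~ s) w) = w.
Proof.
move/allP=> sw; rewrite -map_comp -[RHS]map_id; apply/eq_in_map => x /sw /= le_sx.
exact: subnKC.
Qed.

Lemma perm_map_add s w u : perm_eq (map (addn s) w) (map (addn s) u) -> perm_eq w u.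
Proof.
move/(perm_map (subn^~ s)); rewrite -!map_comp.
by rewrite !(@eq_map _ _ _ id) ?map_id // => x /=; rewrite addKn.
Qed.

(* The entries before the minimum exceed those after it, so sorting both sides
   splits iota into two consecutive intervals. *)
Lemma perm_iota_split m u v : allrel geq u v ->
    perm_eq (u ++ v) (iota m (size u + size v)) ->
  perm_eq v (iota m (size v)) /\ perm_eq u (iota (m + size v) (size u)).
Proof.
move=> uv uvE.
have E : sort leq v ++ sort leq u = iota m (size v + size u).
  apply: (sorted_eq leq_trans anti_leq).
  - rewrite sorted_pairwise ?pairwise_cat -?sorted_pairwise; try exact: leq_trans.
    rewrite !(sort_sorted leq_total) !andbT; apply/allrelP => x y.
    by rewrite !mem_sort => xv yu; apply: (allrelP uv).
  - exact: iota_sorted.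
  - rewrite addnC; apply: perm_trans uvE; rewrite perm_catC.
    by apply: perm_cat; rewrite perm_sort.
move/eqP: E; rewrite iotaD eqseq_cat ?size_sort ?size_iota //.
by case/andP=> /eqP<- /eqP<-; rewrite ![perm_eq _ (sort _ _)]perm_sym !perm_sort.
Qed.

(** Cut at the entry 1: by [av213_cat_min] the two blocks fill consecutive intervals of values,
    which can be shifted down to start at 1. *)
Lemma wordsSP n w : w \in words n.+1 ->
  exists l r, [/\ l \in words (size l), r \in words (n - size l),
                  size l < n.+1 & w = glue l r].
Proof.
rewrite mem_words => /andP[wn avw].
have w1 : 1 \in w by rewrite (perm_mem wn) mem_iota.
case/splitPr: w / w1 wn avw => u v wn.
have uvE : perm_eq (u ++ v) (iota 2 n).
  by move: wn; rewrite -[1 :: v]cat1s perm_catCA /= perm_cons.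
have uv2 : all (leq 2) (u ++ v).
  by apply/allP => x; rewrite (perm_mem uvE) mem_iota => /andP[].
move: (uv2); rewrite all_cat => /andP[u2 v2].
rewrite av213_cat_min // av213_cons_min; last by apply: sub_all v2 => x /ltnW.
case/and3P=> avu avv uv.
have sz : size u + size v = n by rewrite -size_cat (perm_size uvE) size_iota.
have [vE uE] : perm_eq v (iota 2 (size v)) /\ perm_eq u (iota (2 + size v) (size u)).
  by apply: perm_iota_split; rewrite // sz.
have v1 : all (leq 1) v by apply: sub_all v2 => x /ltnW.
have us : all (leq (size v).+1) u.
  by apply/allP => x; rewrite (perm_mem uE) mem_iota => /andP[/ltnW].
exists (map (subn^~ (size v).+1) u), (map (subn^~ 1) v).
have wE : u ++ 1 :: v = glue (map (subn^~ (size v).+1) u) (map (subn^~ 1) v).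
  by rewrite /glue size_map !map_sub_add.
rewrite !mem_words size_map; split; [| |by rewrite ltnS -sz leq_addr|exact: wE].
- rewrite -(av213_map_add (size v).+1) map_sub_add // avu andbT.
  by apply: (@perm_map_add (size v).+1); rewrite map_sub_add // -iotaDl addn1.
- rewrite -(av213_map_add 1) map_sub_add // avv andbT.
  rewrite -sz addKn.
  by apply: (@perm_map_add 1); rewrite map_sub_add // -iotaDl.
Qed.

(** Shifted left entries are at least 2, so the first occurrence of 1 sits at position [size l]. *)
Lemma glue_inj l r l' r' : all (leq 1) l -> all (leq 1) l' ->
  glue l r = glue l' r' -> l = l' /\ r = r'.
Proof.
move=> l1 l1' E.
have idx u v : all (leq 1) u -> index 1 (glue u v) = size u.
  move=> u1; rewrite index_cat size_map /= addn0 ifN //.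
  by apply/negP => /mapP[x /(allP u1) /= x1]; lia.
have sz : size l = size l' by rewrite -(idx l r) // E idx.
move/eqP: E; rewrite eqseq_cat ?size_map // => /andP[/eqP El /eqP[Er]].
have szr : size r = size r' by have := congr1 size Er; rewrite !size_map.
by rewrite szr in El; split; [move: El|move: Er]; apply: inj_map; apply: addnI.
Qed.

(** The tag [a] makes the index list duplicate-free; the map forgets it, but it is recovered as the
    size of the left block. *)
Lemma perm_wordsS n : perm_eq (words n.+1)
  [seq glue x.2.1 x.2.2 | x <- [seq (a, x) | a <- iota 0 n.+1,
                               x <- [seq (l, r) | l <- words a, r <- words (n - a)]]].
Proof.
apply: uniq_perm; first exact: words_uniq.
  rewrite map_inj_in_uniq; last first.
    move=> x y /allpairsPdep[a [_ [_ /allpairsP[[l r] [la ra ->]] ->]]].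
    move=> /allpairsPdep[a' [_ [_ /allpairsP[[l' r'] /= [la' ra' ->]] ->]]] /=.
    move/(glue_inj _ _ _ _ (words_gt0 _ _ la) (words_gt0 _ _ la')) => [El Er].
    have Ea : a = a' by rewrite -(size_words _ _ la) El (size_words _ _ la').
    by move: El Er => /= -> ->; rewrite Ea.
  apply: allpairs_uniq_dep; first exact: iota_uniq.
    by move=> a _; apply: allpairs_uniq; rewrite ?words_uniq // => -[? ?] [? ?].
  by move=> [? ?] [? ?] _ _ /= [-> ->].
move=> w; apply/idP/mapP.
  case/wordsSP=> l [r [lw rw lt_ln ->]]; exists (size l, (l, r)) => //.
  apply/allpairsPdep; exists (size l), (l, r).
  by rewrite mem_iota; split=> //; apply/allpairsP; exists (l, r).
move=> [_ /allpairsPdep[a [_ [ain /allpairsP[[l r] [la ra ->]] ->]]] ->] /=.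
move: ain; rewrite mem_iota => /andP[_ lt_an].
by rewrite -(subnKC (_ : a <= n)) //; apply: mem_glue.
Qed.

Lemma sum_wordsS (V : nmodType) n (F : seq nat -> V) :
  (\sum_(w <- words n.+1) F w =
   \sum_(a < n.+1) \sum_(l <- words a) \sum_(r <- words (n - a)) F (glue l r))%R.
Proof.
rewrite (perm_big _ (perm_wordsS n)) big_map big_allpairs_dep -/(index_iota 0 n.+1).
by rewrite big_mkord; apply: eq_bigr => a _; rewrite big_allpairs_dep.
Qed.

(** * From permutations to words *)

Definition word_of {n} (s : 'S_n) : seq nat := [seq (s i).+1 | i <- enum 'I_n].

Lemma size_word_of n (s : 'S_n) : size (word_of s) = n.
Proof. by rewrite size_map size_enum_ord. Qed.

Lemma nth_word_of {n} (s : 'S_n) (i : 'I_n) : nth 0 (word_of s) i = (s i).+1.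
Proof. by rewrite (nth_map i) ?size_enum_ord // nth_ord_enum. Qed.

Lemma av213_word_of n (s : 'S_n) : av213 (word_of s) = avoids213 s.
Proof.
apply/av213P/idP => [avs|avs p q r lt_pq lt_qr].
  apply/existsP => -[p /existsP[q /existsP[r /and4P[lt_pq lt_qr lt1 lt2]]]].
  have := avs p q r lt_pq lt_qr; rewrite size_word_of !nth_word_of => /(_ (ltn_ord r)).
  by rewrite !ltnS lt1 lt2.
rewrite size_word_of => lt_rn; have lt_qn := ltn_trans lt_qr lt_rn.
have lt_pn := ltn_trans lt_pq lt_qn.
apply: contra avs => lts; apply/existsP; exists (Ordinal lt_pn).
apply/existsP; exists (Ordinal lt_qn); apply/existsP; exists (Ordinal lt_rn).
have nthE k (lt_kn : k < n) := nth_word_of s (Ordinal lt_kn).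
by move: lts; rewrite (nthE _ lt_pn) (nthE _ lt_qn) (nthE _ lt_rn) !ltnS lt_pq lt_qr.
Qed.

(** [word_of] maps ['S_n] injectively into the arrangements of [iota 1 n], and both have [n!]
    elements, so it is onto. *)
Lemma sum_Av213 (V : nmodType) n (F : seq nat -> V) :
  (\sum_(s in Av213 n) F (word_of s) = \sum_(w <- words n) F w)%R.
Proof.
have inj : injective (@word_of n).
  move=> s t st; apply/permP => i; apply: val_inj; apply: succn_inj => /=.
  by rewrite -!nth_word_of st.
have perm_word (s : 'S_n) : perm_eq (word_of s) (iota 1 n).
  apply: uniq_perm; rewrite ?iota_uniq //.
    by rewrite map_inj_uniq ?enum_uniq // => i j [/val_inj/perm_inj].
  have sub : {subset word_of s <= iota 1 n}.
    by move=> _ /mapP[i _ ->]; rewrite mem_iota ltnS add1n ltnS /=.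
  apply: (uniq_min_size _ sub _).2; last by rewrite size_word_of size_iota.
  by rewrite map_inj_uniq ?enum_uniq // => i j [/val_inj/perm_inj].
have E : perm_eq [seq word_of s | s <- enum 'S_n] (permutations (iota 1 n)).
  have u : uniq [seq word_of s | s <- enum 'S_n] by rewrite map_inj_uniq ?enum_uniq.
  apply: uniq_perm; rewrite ?permutations_uniq //.
  apply: (uniq_min_size u _ _).2.
    by move=> _ /mapP[s _ ->]; rewrite mem_permutations.
  by rewrite size_permutations ?iota_uniq // size_iota size_map -cardE card_Sn.
rewrite /words big_filter -(perm_big _ E) /= big_map big_enum_cond /=.
by apply: eq_bigl => s; rewrite !inE av213_word_of.
Qed.

(** * Vertex degrees as column sums *)

(* Row j of a column of height c whose neighbours have heights l and r, a missing
   neighbour having height 0; rows are numbered from 0. *)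
Definition cell_degree (l c r j : nat) : nat :=
  (0 < j) + (j.+1 < c) + (j < l) + (j < r).

Definition cells (d l c r : nat) : nat := \sum_(j < c) (cell_degree l c r j == d).

(** The outer heights [l] and [r] are parameters so that a word can be cut anywhere, each piece
    seeing the border of the other. *)
Fixpoint colsum (F : nat -> nat -> nat -> nat) (l : nat) (w : seq nat) (r : nat) : nat :=
  if w is c :: w' then F l c (head r w') + colsum F c w' r else 0.

Definition wordsum F w := colsum F 0 w 0.

Lemma colsum_cat F l u v r :
  colsum F l (u ++ v) r = colsum F l u (head r v) + colsum F (last l u) v r.
Proof.
elim: u l => [|c u IHu] l //=; rewrite IHu addnA.
by case: u {IHu}.
Qed.

Lemma colsumE F l w :
  colsum F l w 0 = \sum_(i < size w) F (nth 0 (l :: w) i) (nth 0 w i) (nth 0 w i.+1).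
Proof.
elim: w l => [|c w IHw] l; first by rewrite big_ord0.
by rewrite big_ord_recl [LHS]/= IHw -nth0.
Qed.

Lemma distn_eq1 (i j : nat) : (`|i - j|%N == 1) = (i == j.+1) || (j == i.+1).
Proof.
case: (leqP j i) => [le_ji|/ltnW le_ij]; first by rewrite distnEl //; lia.
by rewrite distnEr //; lia.
Qed.

Section Grid.
Variables (n : nat) (s : 'S_n).
Let h := nth 0 (word_of s).

Lemma mem_grid v : (v \in grid_vertices s) = (v.2 < h v.1).
Proof. by rewrite inE /h nth_word_of ltnS. Qed.

(** Stated for arbitrary naturals: beyond the last column [h] takes the default value 0, so a
    candidate neighbour needs no bounds check. *)
Lemma card_grid_point a b :
  \sum_(v in grid_vertices s) ((v.1 == a :> nat) && (v.2 == b :> nat)) = (b < h a).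
Proof.
case: (ltnP b (h a)) => lt_b; last first.
  apply: big1 => v; rewrite mem_grid => v_in.
  case: (v.1 =P a :> nat) => //= va; case: (v.2 =P b :> nat) => //= vb.
  by move: lt_b; rewrite -va -vb leqNgt v_in.
have lt_an : a < n.
  by rewrite ltnNge; apply/negP => le_na; move: lt_b; rewrite /h nth_default ?size_word_of.
have lt_bn : b < n.
  move: lt_b; rewrite /h (nth_word_of s (Ordinal lt_an)) ltnS => /leq_ltn_trans.
  by apply.
rewrite (bigD1 (Ordinal lt_an, Ordinal lt_bn)) ?mem_grid //= !eqxx big1 // => v.
case: v => i j /andP[_]; rewrite xpair_eqE -!val_eqE /=.
by move=> /negbTE->.
Qed.

(** The summands are the neighbours below, above, left and right. As the predecessor of 0 is 0, the
    factors [0 < _] keep [v] from being its own neighbour. *)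
Lemma grid_adj_split (v w : 'I_n * 'I_n) :
  grid_adj v w =
    (0 < v.2) * ((w.1 == v.1 :> nat) && (w.2 == v.2.-1 :> nat))
    + ((w.1 == v.1 :> nat) && (w.2 == v.2.+1 :> nat))
    + (0 < v.1) * ((w.1 == v.1.-1 :> nat) && (w.2 == v.2 :> nat))
    + ((w.1 == v.1.+1 :> nat) && (w.2 == v.2 :> nat)) :> nat.
Proof.
case: v w => i j [i' j']; rewrite /grid_adj /= -!val_eqE /=.
move: (nat_of_ord i) (nat_of_ord j) (nat_of_ord i') (nat_of_ord j') => {i j i' j'} i j i' j'.
rewrite !distn_eq1 ![i == i']eq_sym ![j == j']eq_sym.
case: (ltngtP i' i) => // [lt_i|gt_i|->]; case: (ltngtP j' j) => // [lt_j|gt_j|->];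
  rewrite ?andbF ?andbT ?muln0 ?addn0 //=; lia.
Qed.

Lemma grid_degreeE v : v \in grid_vertices s ->
  grid_degree s v = cell_degree (nth 0 (0 :: word_of s) v.1) (h v.1) (h v.1.+1) v.2.
Proof.
rewrite mem_grid => v_in.
have -> : grid_degree s v = \sum_(w in grid_vertices s) grid_adj v w.
  rewrite /grid_degree -sum1_card -big_mkcondr; apply: eq_bigl => w.
  by rewrite inE.
under eq_bigr do rewrite grid_adj_split.
rewrite !big_split /= -!big_distrr /= !card_grid_point /cell_degree.
congr (_ + _ + _ + _).
(* The cell below a vertex is always a vertex, so only [0 < j] survives. *)
- by case: (val v.2) v_in => //= j /ltnW ->.
- by case: (nat_of_ord v.1) => [|k] /=; rewrite ?mul1n ?mul0n.
Qed.

Lemma card_grid_degree d :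
  #|[set v in grid_vertices s | grid_degree s v == d]| = wordsum (cells d) (word_of s).
Proof.
rewrite -sum1_card /wordsum colsumE size_word_of.
transitivity (\sum_(i < n) \sum_(j < n | j < h i)
    (cell_degree (nth 0 (0 :: word_of s) i) (h i) (h i.+1) j == d)).
  rewrite pair_big_dep /= big_mkcond [RHS]big_mkcond /=; apply: eq_bigr => v _.
  rewrite inE -mem_grid; case v_in : (v \in _) => //=.
  by rewrite grid_degreeE //; case: eqP.
apply: eq_bigr => i _; have le_hn : h i <= n by rewrite /h nth_word_of.
by rewrite /cells (big_ord_widen n (fun j => cell_degree _ _ _ j == d : nat) le_hn).
Qed.

End Grid.

Lemma sum_ltn_ord c m : \sum_(j < c) (j < m) = minn c m.
Proof.
elim: c => [|c IHc]; first by rewrite big_ord0 min0n.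
by rewrite big_ord_recr /= IHc; lia.
Qed.

Lemma sum_succ_eq c x : \sum_(j < c) (j.+1 == c) * x = (0 < c) * x.
Proof.
case: c => [|c]; first by rewrite big_ord0.
rewrite big_ord_recr /= eqxx big1 ?add0n // => i _.
by rewrite eqSS ltn_eqF.
Qed.

Definition peak l c r : nat := (l < c) && (r < c).
(** Height 0 marks a missing neighbour: along a word of positive entries this detects a 1 at either
    end. *)
Definition end_min l c r : nat := (c == 1) * ((l == 0) + (r == 0)).
(** Horizontal edges meeting the column; a sum over a word counts each edge twice. *)
Definition contacts l c r := minn l c + minn c r.
(* A nonzero inner l c r exceeds by one the number of degree 4 vertices of the
   column. *)
Definition inner l c r := minn l (minn c.-1 r).
Definition no_inner l c r : nat := inner l c r == 0.

Lemma cells0 l c r : 0 < c -> 0 < l + r -> cells 0 l c r = 0.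
Proof.
move=> c0 lr0; rewrite /cells big1 // => j _.
by rewrite /cell_degree; lia.
Qed.

(** Only the top vertex can have degree 1: if [1 < c], both neighbours must be shorter; if [c = 1],
    exactly one neighbour must be missing. *)
Lemma cells1 l c r : 0 < c -> 0 < l + r -> cells 1 l c r = peak l c r + end_min l c r.
Proof.
move=> c0 lr0; transitivity ((0 < c) * (peak l c r + end_min l c r)).
  (* The right-hand side becomes a sum supported on the top row, to be compared row by row. *)
  rewrite -sum_succ_eq; apply: eq_bigr => j _.
  have := ltn_ord j; rewrite /cell_degree /peak /end_min; lia.
by rewrite c0 mul1n.
Qed.

(** Degree 4 means [0 < j < inner l c r]. Row 0 accounts for the 1, and [no_inner] supplies it when
    there is no row to discard. *)
Lemma cells4 l c r : cells 4 l c r + 1 = inner l c r + no_inner l c r.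
Proof.
have -> : inner l c r = minn c (inner l c r) by rewrite /inner; lia.
rewrite -sum_ltn_ord /no_inner.
suff : cells 4 l c r + minn c (0 < inner l c r) = \sum_(j < c) (j < inner l c r).
  by rewrite /inner; lia.
rewrite -sum_ltn_ord -big_split; apply: eq_bigr => j _.
have := ltn_ord j; rewrite /cell_degree /inner /=. lia.
Qed.

Lemma cells_sum l c r :
  cells 0 l c r + cells 1 l c r + cells 2 l c r + cells 3 l c r + cells 4 l c r = c.
Proof.
rewrite -[RHS]card_ord -sum1_card -!big_split; apply: eq_bigr => j _ /=.
rewrite /cell_degree; lia.
Qed.

(** Handshake count in one column: the degrees add up to [2 * (c - 1)] vertical edge ends plus
    [contacts l c r]. *)
Lemma cells_degree_sum l c r : 0 < c ->
  cells 1 l c r + 2 * cells 2 l c r + 3 * cells 3 l c r + 4 * cells 4 l c r + 2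
  = 2 * c + contacts l c r.
Proof.
move=> c0; rewrite !big_distrr -!big_split /=.
transitivity (\sum_(j < c) cell_degree l c r j + 2).
  congr (_ + _); apply: eq_bigr => j _; rewrite /cell_degree; lia.
rewrite !big_split /= !sum_ltn_ord /contacts.
have -> : \sum_(j < c) (0 < j) = c.-1.
  case: c c0 => // c _; rewrite big_ord_recl /= add0n.
  by rewrite -[RHS]card_ord -sum1_card.
have -> : \sum_(j < c) (j.+1 < c) = c.-1.
  rewrite -[RHS](minn_idPr (leq_pred c)) -sum_ltn_ord; apply: eq_bigr => j _; lia.
lia.
Qed.

(** * Column sums under the decomposition *)

(** The column of height 1 borders both blocks; an empty block leaves height 0 beside it. *)
Lemma wordsum_glue F l r :
  wordsum F (glue l r) =
    colsum F 0 (map (addn (size r).+1) l) 1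
    + F (last 0 (map (addn (size r).+1) l)) 1 (head 0 (map (addn 1) r))
    + colsum F 1 (map (addn 1) r) 0.
Proof. by rewrite /wordsum /glue colsum_cat /= addnA. Qed.

Lemma last_map_gt0 s w : (0 < last 0 (map (addn s.+1) w)) = (0 < size w).
Proof. by case/lastP: w => // w x; rewrite map_rcons last_rcons size_rcons. Qed.

Lemma head_map_gt0 s w : (0 < head 0 (map (addn s.+1) w)) = (0 < size w).
Proof. by case: w. Qed.

(** A common shift preserves comparisons, and borders of height at most [s] stay below every shifted
    entry, as 0 does before the shift. *)
Lemma colsum_peak_shift s l w r : all (leq 1) w -> l <= s -> r <= s ->
  colsum peak l (map (addn s) w) r = wordsum peak w.
Proof.
case: w => //= c w /andP[c0 w0] le_ls le_rs.
have cons_shift x u : all (leq 1) (x :: u) ->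
    colsum peak (s + x) (map (addn s) u) r = colsum peak x u 0.
  elim: u x => //= y u IHu x /and3P[x0 y0 u0]; rewrite IHu /= ?y0 //; congr addn.
  by case: u u0 {IHu} => [|z u] _ /=; rewrite /peak; lia.
rewrite /wordsum /= cons_shift /= ?c0 //; congr addn.
by case: w w0 => [|z u] _ /=; rewrite /peak; lia.
Qed.

Lemma wordsum_peak_glue l r : all (leq 1) l -> all (leq 1) r ->
  wordsum peak (glue l r)
  = wordsum peak l + wordsum peak r + ((size l == 0) && (size r == 0)).
Proof.
move=> l0 r0; rewrite wordsum_glue !colsum_peak_shift // addnAC; congr (_ + _).
by rewrite /peak !ltnS !leqn0 !eqn0Ngt last_map_gt0 head_map_gt0.
Qed.

Lemma colsum_end_min_shift s l w r : all (leq 1) w -> 0 < s ->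
  colsum end_min l (map (addn s) w) r = 0.
Proof.
move=> w0 s0; elim: w l w0 => //= c w IHw l /andP[c0 w0].
by rewrite IHw // /end_min; lia.
Qed.

Lemma wordsum_end_min_glue l r : all (leq 1) l -> all (leq 1) r ->
  wordsum end_min (glue l r) = (size l == 0) + (size r == 0).
Proof.
move=> l0 r0; rewrite wordsum_glue !colsum_end_min_shift // addn0.
by rewrite /end_min mul1n !eqn0Ngt last_map_gt0 head_map_gt0.
Qed.

(** Each of the [(size w).-1] internal contacts grows by [s] and is counted twice; the right border
    adds a contact of length [r]. *)
Lemma colsum_contacts_shift s w r : all (leq 1) w -> r <= 1 -> 0 < size w ->
  colsum contacts 0 (map (addn s) w) r
  = wordsum contacts w + 2 * (size w).-1 * s + r.
Proof.
case: w => //= c w w0 r1 _.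
have cons_shift x y u : all (leq 1) (x :: y :: u) ->
    colsum contacts (s + x) (map (addn s) (y :: u)) r
    = colsum contacts x (y :: u) 0 + (2 * size u).+1 * s + r.
  elim: u x y => [|z u IHu] x y.
    by rewrite /= /contacts => /and3P[]; lia.
  move=> /= /and4P[x0 y0 z0 u0]; have := IHu y z; rewrite /= y0 z0 u0 => -> //.
  by rewrite /contacts; nia.
rewrite /wordsum; case: w w0 => [|d w] w0.
  by move: w0; rewrite /= /contacts => /andP[]; lia.
have := cons_shift _ _ _ w0; rewrite /= => ->.
by rewrite /contacts; nia.
Qed.

Lemma colsum_contacts_left w : all (leq 1) w ->
  colsum contacts 1 w 0 = wordsum contacts w + (0 < size w).
Proof. by case: w => //= c w /andP[c0 _]; rewrite /wordsum /= /contacts; lia. Qed.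

(** Internal contacts grow by [(size r).+1] on the left and by 1 on the right, and each nonempty
    block shares one edge with the 1. The right-hand gains merge into [2 * size r]. *)
Lemma wordsum_contacts_glue l r : all (leq 1) l -> all (leq 1) r ->
  wordsum contacts (glue l r) = wordsum contacts l + wordsum contacts r
    + (2 * (size l).-1 * (size r).+1 + 2 * (0 < size l) + 2 * size r).
Proof.
move=> l0 r0; rewrite wordsum_glue colsum_contacts_left; last first.
  by apply/allP => _ /mapP[x _ ->].
have mid x y : contacts x 1 y = (0 < x) + (0 < y) by rewrite /contacts; lia.
rewrite mid last_map_gt0 head_map_gt0 size_map {mid}.
have r_shift : wordsum contacts (map (addn 1) r) = wordsum contacts r + 2 * (size r).-1.
  by case: r r0 => // c r r0; rewrite /wordsum colsum_contacts_shift // addn0 muln1.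
rewrite r_shift.
case: l l0 => [|c l] l0.
  by rewrite /wordsum /=; case: (size r) => [|b] /=; lia.
by rewrite colsum_contacts_shift //; case: (size r) => [|b] /=; lia.
Qed.

(** The first column gives 0, each of the [(size w).-2] middle columns gains [s], and the last is
    capped by the border [r]. *)
Lemma colsum_inner_shift s w r : all (leq 1) w -> r <= 1 -> 0 < s ->
  colsum inner 0 (map (addn s) w) r
  = wordsum inner w + (size w).-2 * s + (1 < size w) * r.
Proof.
move=> w0 r1 s0; case: w w0 => //= c w w0.
have cons_shift x y u : all (leq 1) (x :: y :: u) ->
    colsum inner (s + x) (map (addn s) (y :: u)) r
    = colsum inner x (y :: u) 0 + size u * s + r.
  elim: u x y => [|z u IHu] x y.
    by rewrite /= /inner => /and3P[]; lia.
  move=> /= /and4P[x0 y0 z0 u0]; have := IHu y z; rewrite /= y0 z0 u0 => -> //.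
  by rewrite /inner; nia.
rewrite /wordsum; case: w w0 => [|d w] w0.
  by move: w0; rewrite /= /inner => /andP[]; lia.
have := cons_shift _ _ _ w0; rewrite /= => ->.
by rewrite /inner; nia.
Qed.

Lemma colsum_inner_left w : all (leq 2) w ->
  colsum inner 1 w 0 = wordsum inner w + (1 < size w).
Proof.
case: w => //= c [|d w] /andP[c0 w0]; rewrite /wordsum /= /inner; first lia.
by case/andP: w0; lia.
Qed.

(** The column of the 1 contributes nothing, since there [c.-1 = 0]. On the right, [(size r).-2] and
    the border term combine to [(size r).-1]. *)
Lemma wordsum_inner_glue l r : all (leq 1) l -> all (leq 1) r ->
  wordsum inner (glue l r) = wordsum inner l + wordsum inner r
    + ((size l).-2 * (size r).+1 + (1 < size l) + (size r).-1).
Proof.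
move=> l0 r0; rewrite wordsum_glue colsum_inner_left; last first.
  by apply/allP => _ /mapP[x /(allP r0) /= x0 ->]; lia.
have -> x y : inner x 1 y = 0 by rewrite /inner; lia.
rewrite /wordsum !colsum_inner_shift // size_map.
by rewrite /wordsum; case: (size r) => [|[|b]] /=; lia.
Qed.

Lemma colsum_no_inner_shift s w x : all (leq 1) w -> 0 < x -> 0 < s ->
  colsum no_inner x (map (addn s) w) 1 = 0 /\
  colsum no_inner x (map (addn s) w) 0 = (0 < size w).
Proof.
move=> + + s0; elim: w x => //= c w IHw x /andP[c0 w0] x0.
have [|-> ->] := IHw (s + c) w0; first by lia.
by case: w w0 {IHw} => [|d w] w0; rewrite /no_inner /inner /=; lia.
Qed.

(** [inner] vanishes exactly at the two end columns and at the column of the 1. *)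
Lemma wordsum_no_inner_glue l r : all (leq 1) l -> all (leq 1) r ->
  wordsum no_inner (glue l r) = (0 < size l) + 1 + (0 < size r).
Proof.
move=> l0 r0; rewrite wordsum_glue (colsum_no_inner_shift _ _ _ r0 _ _).2 //.
congr (_ + _ + _); last by rewrite /no_inner /inner; lia.
case: l l0 => //= c l /andP[c0 l0].
by rewrite (colsum_no_inner_shift _ _ _ l0 _ _).1 ?addn0 // /no_inner /inner min0n.
Qed.

Import GRing.Theory Num.Theory.
Local Open Scope ring_scope.

(** * Formal power series *)

Definition fps : Type := nat -> rat.

(** Equality of sequences is not decidable, so the structures below the ring structure are obtained
    classically. *)
HB.instance Definition _ := boolp.gen_eqMixin fps.
HB.instance Definition _ := boolp.gen_choiceMixin fps.

Lemma fpsP (u v : fps) : u =1 v -> u = v.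
Proof. exact: boolp.funext. Qed.

Definition fps_zero : fps := fun _ => 0.
Definition fps_opp (u : fps) : fps := fun n => - u n.
Definition fps_add (u v : fps) : fps := fun n => u n + v n.

Lemma fps_addA : associative fps_add.
Proof. by move=> u v w; apply: fpsP => n; apply: addrA. Qed.

Lemma fps_addC : commutative fps_add.
Proof. by move=> u v; apply: fpsP => n; apply: addrC. Qed.

Lemma fps_add0 : left_id fps_zero fps_add.
Proof. by move=> u; apply: fpsP => n; apply: add0r. Qed.

Lemma fps_addN : left_inverse fps_zero fps_opp fps_add.
Proof. by move=> u; apply: fpsP => n; apply: addNr. Qed.

HB.instance Definition _ :=
  GRing.isZmodule.Build fps fps_addA fps_addC fps_add0 fps_addN.

Definition fps_one : fps := fun n => (n == 0%N)%:R.
Definition fps_mul (u v : fps) : fps :=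
  fun n => \sum_(i < n.+1) u i * v (n - i)%N.

(** A coefficient of a product depends only on finitely many coefficients, so associativity and
    commutativity transfer from truncations in [{poly rat}]. *)
Lemma coef_fps_mul (p q : {poly rat}) (u v : fps) n :
    (forall i, (i <= n)%N -> p`_i = u i) ->
    (forall i, (i <= n)%N -> q`_i = v i) ->
  (p * q)`_n = fps_mul u v n.
Proof.
move=> pu qv; rewrite coefM; apply: eq_bigr => i _.
by rewrite pu ?qv ?leq_subr // -ltnS.
Qed.

Lemma coef_trunc (u : fps) n i : (i <= n)%N -> (\poly_(j < n.+1) u j)`_i = u i.
Proof. by move=> le_in; rewrite coef_poly ltnS le_in. Qed.

Lemma fps_mulE (u v : fps) n i : (i <= n)%N ->
  (\poly_(j < n.+1) u j * \poly_(j < n.+1) v j)`_i = fps_mul u v i.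
Proof.
move=> le_in; apply: coef_fps_mul => j le_ji;
  by rewrite coef_trunc // (leq_trans le_ji).
Qed.

Lemma fps_mulA : associative fps_mul.
Proof.
move=> u v w; apply: fpsP => n.
rewrite -(coef_fps_mul (\poly_(j < n.+1) u j)
  (\poly_(j < n.+1) v j * \poly_(j < n.+1) w j));
  [|exact: coef_trunc|exact: fps_mulE].
by rewrite mulrA; apply: coef_fps_mul; [exact: fps_mulE|exact: coef_trunc].
Qed.

Lemma fps_mulC : commutative fps_mul.
Proof.
by move=> u v; apply: fpsP => n; rewrite -!(@fps_mulE _ _ n) // mulrC.
Qed.

Lemma fps_mul1 : left_id fps_one fps_mul.
Proof.
move=> u; apply: fpsP => n; rewrite /fps_mul big_ord_recl /= subn0 mul1r.
by rewrite big1 ?addr0 // => i _; rewrite /fps_one mul0r.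
Qed.

Lemma fps_mulDl : left_distributive fps_mul fps_add.
Proof.
move=> u v w; apply: fpsP => n; rewrite /fps_mul /fps_add -big_split.
by apply: eq_bigr => i _; rewrite mulrDl.
Qed.

Lemma fps_oner_neq0 : fps_one != 0.
Proof. by apply/eqP => /(congr1 (@^~ 0%N)). Qed.

HB.instance Definition _ := GRing.Zmodule_isComNzRing.Build fps
  fps_mulA fps_mulC fps_mul1 fps_mulDl fps_oner_neq0.

Lemma fps1E n : (1 : fps) n = (n == 0%N)%:R. Proof. by []. Qed.
Lemma fpsDE (u v : fps) n : (u + v) n = u n + v n. Proof. by []. Qed.
Lemma fpsNE (u : fps) n : (- u) n = - u n. Proof. by []. Qed.
Lemma fpsME (u v : fps) n : (u * v) n = \sum_(i < n.+1) u i * v (n - i)%N.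
Proof. by []. Qed.

Lemma fpsMnE (u : fps) m n : (u *+ m) n = u n *+ m.
Proof. by elim: m => [|m IHm]; rewrite ?mulr0n // !mulrS fpsDE IHm. Qed.

Lemma fps_natME (u : fps) m n : (m%:R * u) n = m%:R * u n.
Proof. by rewrite !mulr_natl fpsMnE. Qed.

Definition fpsX : fps := fun n => (n == 1%N)%:R.

Lemma fpsXM0 (u : fps) : (fpsX * u) 0%N = 0.
Proof. by rewrite fpsME big_ord1 mul0r. Qed.

Lemma fpsXMS (u : fps) n : (fpsX * u) n.+1 = u n.
Proof.
rewrite fpsME big_ord_recl mul0r add0r big_ord_recl /= mul1r subSS subn0.
by rewrite big1 ?addr0 // => i _; rewrite mul0r.
Qed.

Definition fpsXE := (fpsXM0, fpsXMS).

Lemma fpsX_inj (u v : fps) : fpsX * u = fpsX * v -> u = v.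
Proof. by move=> uv; apply: fpsP => n; have := congr1 (@^~ n.+1) uv; rewrite !fpsXMS. Qed.

Lemma fps_nat_inj m (u v : fps) : m.+1%:R * u = m.+1%:R * v -> u = v.
Proof.
move=> uv; apply: fpsP => n; apply: (@mulfI _ m.+1%:R); first by rewrite pnatr_eq0.
by have := congr1 (@^~ n) uv; rewrite !fps_natME.
Qed.

(* The Euler operator x d/dx. *)
Definition euler (u : fps) : fps := fun n => n%:R * u n.

Lemma eulerM (u v : fps) : euler (u * v) = euler u * v + u * euler v.
Proof.
apply: fpsP => n; rewrite fpsDE !fpsME -big_split /euler fpsME mulr_sumr.
apply: eq_bigr => i _ /=; have le_in : (i <= n)%N by rewrite -ltnS.
by rewrite -{1}(subnKC le_in) natrD; ring.
Qed.

Lemma euler0_eq1 (u : fps) : u 0%N = 1 -> euler u = 0 -> u = 1.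
Proof.
move=> u0 eu0; apply: fpsP => -[|n]; first by rewrite u0.
by have /eqP := congr1 (@^~ n.+1) eu0; rewrite mulf_eq0 pnatr_eq0 => /eqP.
Qed.

(** * Central binomial and Catalan series *)

Definition centralb : fps := fun n => 'C(2 * n, n)%:R.
Definition catalan : fps := fun n => centralb n / n.+1%:R.
Definition pow4 : fps := fun n => 4 ^+ n.

Lemma centralbS n : n.+1%:R * centralb n.+1 = 2 * (2 * n%:R + 1) * centralb n.
Proof.
have h k : centralb k * (k`!%:R * k`!%:R) = (2 * k)`!%:R.
  have le_k : (k <= 2 * k)%N by lia.
  rewrite /centralb -!natrM; congr _%:R; rewrite -[RHS](bin_fact le_k).
  by congr (_ * (_ * _`!))%N; lia.
have fn0 : n`!%:R != 0 :> rat by rewrite pnatr_eq0 -lt0n fact_gt0.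
have n1 : n.+1%:R != 0 :> rat by rewrite pnatr_eq0.
apply: (mulIf fn0); apply: (mulIf fn0); apply: (mulIf n1).
have := h n.+1; rewrite (_ : 2 * n.+1 = (2 * n).+2)%N ?mulnS // !factS !natrM -h => e.
transitivity (centralb n.+1 * (n.+1%:R * n`!%:R * (n.+1%:R * n`!%:R))); first by ring.
by rewrite e -!natr1 natrM; ring.
Qed.

Lemma catalanE n : n.+1%:R * catalan n = centralb n.
Proof. by rewrite /catalan mulrC divfK // pnatr_eq0. Qed.

Lemma euler_centralb :
  euler centralb = 2 * (fpsX * centralb) + 4 * (fpsX * euler centralb).
Proof.
apply: fpsP => -[|n]; rewrite fpsDE !fps_natME !fpsXE /euler ?mul0r ?mulr0 ?add0r //.
by rewrite centralbS; ring.
Qed.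

(** The constant term is 1, and the differential equation [euler_centralb] makes the Euler
    derivative vanish. *)
Lemma centralb_sqr : (1 - 4 * fpsX) * centralb ^+ 2 = 1.
Proof.
apply: euler0_eq1.
  by rewrite mulrBl mul1r fpsDE fpsNE -mulrA fps_natME fpsXE expr2 fpsME big_ord1.
have e1 : euler (1 - 4 * fpsX) = - (4 * fpsX).
  apply: fpsP => n; rewrite /euler fpsDE !fpsNE !fps_natME fps1E /fpsX.
  by case: n => [|[|n]] /=; ring.
rewrite eulerM e1 expr2 eulerM.
have e2 := euler_centralb; set E := euler _ in e2 *.
have e3 : (1 - 4 * fpsX) * E = 2 * (fpsX * centralb).
  by rewrite mulrBl mul1r {1}e2; ring.
transitivity (- (4 * fpsX) * (centralb * centralb)
  + 2 * centralb * ((1 - 4 * fpsX) * E)); first by ring.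
by rewrite e3; ring.
Qed.

(** The usual closed form: [(1 - 4 * fpsX) * centralb] is the square root of [1 - 4 * fpsX]. *)
Lemma catalan_centralb : 2 * (fpsX * catalan) = 1 - (1 - 4 * fpsX) * centralb.
Proof.
apply: fpsP => -[|n]; rewrite mulrBl mul1r -mulrA !fpsDE !fpsNE fpsDE fpsNE
  !fps_natME !fpsXE fps1E ?mulr0 ?subr0 //.
rewrite sub0r /catalan; have n1 : n.+1%:R != 0 :> rat by rewrite pnatr_eq0.
apply: (mulfI n1); rewrite mulrN mulrBr centralbS -natr1 in n1 *.
by field.
Qed.

Lemma catalan_fix : fpsX * catalan ^+ 2 = catalan - 1.
Proof.
(* Multiplying by [4 * fpsX] (the argument 3 encodes the factor 4) exposes the square of the closed
   form. *)
apply/fpsX_inj/(@fps_nat_inj 3).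
have e := catalan_centralb; have b2 := centralb_sqr.
transitivity ((2 * (fpsX * catalan)) ^+ 2); first by ring.
transitivity (2 * (2 * (fpsX * catalan)) - 4 * fpsX); last by ring.
rewrite e; transitivity (1 - 2 * ((1 - 4 * fpsX) * centralb)
  + (1 - 4 * fpsX) * ((1 - 4 * fpsX) * centralb ^+ 2)); first by ring.
by rewrite b2; ring.
Qed.

Lemma catalan_mul_centralb : 2 * (fpsX * catalan * centralb) = centralb - 1.
Proof.
rewrite mulrA catalan_centralb mulrBl mul1r -{3}centralb_sqr.
by ring.
Qed.

Lemma euler_catalan : euler catalan = centralb - catalan.
Proof. by apply: fpsP => n; rewrite fpsDE fpsNE -catalanE /euler -natr1; ring. Qed.

Lemma euler_centralbE : euler centralb = 2 * (fpsX * centralb ^+ 3).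
Proof.
have e := euler_centralb; set E := euler _ in e *.
rewrite -[LHS]mulr1 -[X in _ * X = _]centralb_sqr.
transitivity (centralb ^+ 2 * (E - 4 * (fpsX * E))); first by ring.
by rewrite {1}e; ring.
Qed.

(** Both series are inverse to [1 - 4 * fpsX]. *)
Lemma pow4E : pow4 = centralb ^+ 2.
Proof.
have e : (1 - 4 * fpsX) * pow4 = 1.
  apply: fpsP => -[|n]; rewrite mulrBl mul1r -mulrA fpsDE fpsNE fps_natME !fpsXE
    ?mulr0 ?subr0 //.
  by rewrite /pow4 exprS subrr.
rewrite -[LHS]mulr1 -[X in _ * X = _]centralb_sqr.
transitivity ((1 - 4 * fpsX) * pow4 * centralb ^+ 2).
  by ring.
by rewrite e mul1r.
Qed.

(* 1 - 2 x catalan is inverse to centralb. *)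
Lemma fps_solve (u g : fps) : u = 2 * (fpsX * catalan * u) + g -> u = centralb * g.
Proof.
move=> e; have -> : g = u - 2 * (fpsX * catalan * u) by rewrite {1}e addrAC subrr add0r.
transitivity (u * (centralb - 2 * (fpsX * catalan * centralb))); last by ring.
by rewrite catalan_mul_centralb opprB addrC subrK mulr1.
Qed.

(** After [fps_solve], [catalan] occurs only inside [2 * (fpsX * catalan * centralb)], which is
    [centralb - 1]. *)
Lemma fps_solve_contacts (H : fps) :
    H = 2 * (fpsX * catalan * H)
        + fpsX * (2 * (euler catalan * centralb + euler catalan)) ->
  H = euler centralb + 2 * (fpsX * pow4) - pow4 + 1.
Proof.
move/fps_solve=> ->; rewrite euler_centralbE pow4E euler_catalan.
transitivity (2 * (fpsX * centralb ^+ 3) + 2 * (fpsX * centralb ^+ 2)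
  - (centralb + 1) * (2 * (fpsX * catalan * centralb))); first by ring.
by rewrite catalan_mul_centralb; ring.
Qed.

(** Doubling makes every term with [catalan] a multiple of [2 * (fpsX * catalan * centralb)]; one
    product [catalan * centralb] remains after the substitution. *)
Lemma fps_solve_inner (K : fps) :
    K = 2 * (fpsX * catalan * K) + fpsX *
      (euler catalan * centralb - catalan * euler catalan - 2 * (catalan * catalan)
       + 2 * euler catalan + 2 * catalan + fpsX * euler catalan) ->
  2 * K = euler centralb - 2 * pow4 + 4 * (fpsX * pow4)
    + 2 * (fpsX * (fpsX * pow4)) + 2 * centralb - catalan * centralb + catalan
    - fpsX * centralb + fpsX.
Proof.
move/fps_solve=> ->; rewrite euler_centralbE pow4E euler_catalan.
transitivity (2 * (fpsX * centralb ^+ 3) + 4 * (fpsX * centralb ^+ 2)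
  + 2 * (fpsX * (fpsX * centralb ^+ 2))
  - (2 * centralb + catalan + fpsX) * (2 * (fpsX * catalan * centralb))).
  by ring.
by rewrite catalan_mul_centralb; ring.
Qed.

Lemma catalan_unique (c : fps) : c 0%N = 1 ->
  (forall n, c n.+1 = \sum_(i < n.+1) c i * c (n - i)%N) -> c = catalan.
Proof.
move=> c0 cS; apply: fpsP => n; elim/ltn_ind: n => -[|n] IHn; first by rewrite c0.
rewrite cS; transitivity ((fpsX * (catalan * catalan)) n.+1).
  rewrite fpsXMS fpsME; apply: eq_bigr => i _.
  by rewrite !IHn // ltnS leq_subr.
by rewrite -expr2 catalan_fix fpsDE fpsNE subr0.
Qed.

(** * Generating functions *)

Lemma QE d n : Q d n = (\sum_(w <- words n) wordsum (cells d) w)%N.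
Proof.
rewrite -sum_Av213; apply: eq_bigr => s _; exact: card_grid_degree.
Qed.

Definition wsum (f : seq nat -> nat) : fps := fun n => \sum_(w <- words n) (f w)%:R.

Lemma words0 : words 0 = [:: [::]]. Proof. by []. Qed.

Lemma wsum1 : wsum (fun=> 1%N) = catalan.
Proof.
apply: catalan_unique => [|n]; first by rewrite /wsum words0 big_seq1.
rewrite /wsum sum_wordsS; apply: eq_bigr => a _; rewrite big_distrlr /=.
by under [RHS]eq_bigr do under eq_bigr do rewrite mulr1.
Qed.

Lemma wsum_glue f (g : nat -> nat -> nat) n :
    (forall l r, all (leq 1) l -> all (leq 1) r -> f (glue l r) = g (size l) (size r)) ->
  wsum f n.+1 = \sum_(a < n.+1) catalan a * catalan (n - a)%N * (g a (n - a)%N)%:R.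
Proof.
move=> fg; rewrite /wsum sum_wordsS; apply: eq_bigr => a _.
rewrite -wsum1 /wsum big_distrlr mulr_suml big_seq [RHS]big_seq.
apply: eq_bigr => l la; rewrite mulr_suml big_seq [RHS]big_seq; apply: eq_bigr => r ra.
rewrite fg; [|exact: words_gt0 la|exact: words_gt0 ra].
by rewrite (size_words _ _ la) (size_words _ _ ra) !mul1r.
Qed.

(** Summed over all pairs of blocks, [f l] and [f r] each give the product of [catalan] and
    [wsum f], whence the factor 2; [g] gives the source term. *)
Lemma wsum_glue_add f (g : nat -> nat -> nat) :
    f [::] = 0%N ->
    (forall l r, all (leq 1) l -> all (leq 1) r ->
       f (glue l r) = (f l + f r + g (size l) (size r))%N) ->
  wsum f = 2 * (fpsX * catalan * wsum f) + fpsX *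
    (fun n => \sum_(a < n.+1) catalan a * catalan (n - a)%N * (g a (n - a)%N)%:R : rat).
Proof.
move=> f0 fg; apply: fpsP => -[|n].
  by rewrite fpsDE fps_natME -mulrA !fpsXE mulr0 addr0 /wsum words0 big_seq1 f0.
rewrite fpsDE fps_natME -mulrA !fpsXE [2]mulr2n mulrDl mul1r {2}[catalan * _]mulrC !fpsME.
rewrite -!big_split /wsum sum_wordsS; apply: eq_bigr => a _ /=.
rewrite -wsum1 /wsum !big_distrlr mulr_suml -!big_split /=.
rewrite big_seq [RHS]big_seq; apply: eq_bigr => l la.
rewrite mulr_suml -!big_split /= big_seq [RHS]big_seq; apply: eq_bigr => r ra.
rewrite fg; [|exact: words_gt0 la|exact: words_gt0 ra].
by rewrite (size_words _ _ la) (size_words _ _ ra) !natrD; ring.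
Qed.

Lemma catalan0 : catalan 0%N = 1.
Proof. by rewrite /catalan /centralb bin0 divr1. Qed.

Lemma catalan_mul_eq0 n : catalan n * (n == 0%N)%:R = (n == 0%N)%:R.
Proof. by case: n => [|n]; rewrite ?catalan0 ?mulr0 ?mul1r. Qed.

Lemma catalan1 : catalan 1%N = 1.
Proof. by rewrite /catalan /centralb; apply/eqP. Qed.

(** The source comes from the one-letter word alone, so it is [fpsX]. *)
Lemma wsum_peak : wsum (wordsum peak) = centralb * fpsX.
Proof.
apply: fps_solve.
apply: etrans (wsum_glue_add _ (fun a b => (a == 0) && (b == 0))%N erefl wordsum_peak_glue) _.
congr (_ + _); rewrite -[RHS]mulr1; congr (_ * _); apply: fpsP => n.
rewrite big_ord_recl subn0 catalan0 mul1r big1 ?addr0; last by move=> i _; rewrite /= mulr0.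
by case: n => [|n]; rewrite ?catalan0 ?mulr0 // mul1r.
Qed.

Lemma wsum_end_min n : wsum (wordsum end_min) n.+1 = 2 * catalan n.
Proof.
rewrite (wsum_glue _ (fun a b => (a == 0) + (b == 0))%N _ wordsum_end_min_glue).
transitivity ((1 * catalan + catalan * 1) n); last first.
  by rewrite mul1r mulr1 fpsDE; ring.
rewrite fpsDE !fpsME -big_split; apply: eq_bigr => a _ /=.
rewrite natrD mulrDr !fps1E; congr (_ + _).
  by rewrite mulrAC catalan_mul_eq0.
by rewrite -mulrA catalan_mul_eq0.
Qed.

Lemma wsum_contacts :
  wsum (wordsum contacts) = euler centralb + 2 * (fpsX * pow4) - pow4 + 1.
Proof.
apply: fps_solve_contacts.
apply: etrans (wsum_glue_add _
  (fun a b => 2 * a.-1 * b.+1 + 2 * (0 < a) + 2 * b)%N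
  erefl wordsum_contacts_glue) _.
congr (_ + _ * _).
(* The weight is [2 * a * b.+1], plus [2 * b] when [a = 0]; by [catalanE] the factor [b.+1] turns
   [catalan] into [centralb]. *)
transitivity (2 * (euler catalan * centralb) + 1 * (2 * euler catalan) : fps); last by ring.
apply: fpsP => n.
rewrite fpsDE fps_natME !fpsME mulr_sumr -big_split; apply: eq_bigr => a _ /=.
rewrite fps1E fps_natME /euler -catalanE.
move: (nat_of_ord a) (n - a)%N => {n a} [|a] b /=.
  by rewrite catalan0 -natr1 !natrD !natrM; ring.
by rewrite -!natr1 !natrD !natrM -!natr1; ring.
Qed.

Lemma wsum_inner :
  2 * wsum (wordsum inner) = euler centralb - 2 * pow4 + 4 * (fpsX * pow4)
    + 2 * (fpsX * (fpsX * pow4)) + 2 * centralb - catalan * centralb + catalan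
    - fpsX * centralb + fpsX.
Proof.
apply: fps_solve_inner.
apply: etrans (wsum_glue_add _
  (fun a b => a.-2 * b.+1 + (1 < a) + b.-1)%N
  erefl wordsum_inner_glue) _.
congr (_ + _ * _).
(* For [1 < a] and [0 < b] the weight is [a * (b + 1) - b - 2]. The truncated predecessors add
   [2 * b + 1] at [a = 0], [b] at [a = 1] and 1 at [b = 0]. *)
transitivity (euler catalan * centralb - catalan * euler catalan
  - 2 * (catalan * catalan) + 1 * (2 * euler catalan) + 1 * catalan + catalan * 1
  + fpsX * euler catalan : fps); last by ring.
apply: fpsP => n.
rewrite !(fpsDE, fpsNE) fps_natME !fpsME mulr_sumr -!sumrN -!big_split.
apply: eq_bigr => a _ /=.
rewrite !fps1E fps_natME /euler -catalanE /fpsX.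
move: (nat_of_ord a) (n - a)%N => {n a} [|[|a]] [|b] /=;
  rewrite ?catalan0 ?catalan1 ?natrD ?natrM -?natr1; ring.
Qed.

Lemma wsumD (f g : seq nat -> nat) n :
  wsum (fun w => f w + g w)%N n = wsum f n + wsum g n.
Proof. by rewrite /wsum -big_split; apply: eq_bigr => w _; rewrite natrD. Qed.

(** * Column identities summed along a word *)

Section Words.
Variables (n : nat) (w : seq nat).
Hypotheses (n2 : (1 < n)%N) (w_in : w \in words n).

(** As [1 < n], every column has a nonempty neighbour, as [cells0] and [cells1] require. *)
Lemma words_cell_gt0 (i : 'I_(size w)) :
  (0 < nth 0 w i)%N /\ (0 < nth 0 (0 :: w) i + nth 0 w i.+1)%N.
Proof.
have gt0 j : (j < size w)%N -> (0 < nth 0 w j)%N.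
  by move=> lt_j; apply: (all_nthP 0 (words_gt0 _ _ w_in)).
split; first exact: gt0.
case: i => [[|i] lt_i] /=; first by rewrite gt0 // (size_words _ _ w_in).
by rewrite addn_gt0 gt0 // ltnW.
Qed.

Lemma wordsum_cells1 :
  (wordsum (cells 1) w = wordsum peak w + wordsum end_min w)%N.
Proof.
rewrite /wordsum !colsumE -big_split; apply: eq_bigr => i _.
by have [] := words_cell_gt0 i; apply: cells1.
Qed.

Lemma wordsum_cells4 :
  (wordsum (cells 4) w + n = wordsum inner w + wordsum no_inner w)%N.
Proof.
rewrite -{1}(size_words _ _ w_in) -[X in (_ + X)%N]card_ord -sum1_card.
rewrite /wordsum !colsumE -!big_split; apply: eq_bigr => i _; exact: cells4.
Qed.

(** Each block is counted once, by [no_inner] if nonempty and by [end_min] if empty; the column of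
    the 1 is the third. *)
Lemma wordsum_no_inner_end_min : (wordsum no_inner w + wordsum end_min w = 3)%N.
Proof.
case: n n2 w_in => // m _ /wordsSP[l [r [/words_gt0 l0 /words_gt0 r0 _ ->]]].
by rewrite wordsum_no_inner_glue // wordsum_end_min_glue //; lia.
Qed.

Lemma wordsum_height : (2 * wordsum (fun _ c _ => c) w = n * n.+1)%N.
Proof.
have -> : wordsum (fun _ c _ => c) w = (\sum_(x <- w) x)%N.
  by rewrite /wordsum colsumE (big_nth 0) big_mkord.
move: w_in; rewrite mem_words => /andP[w_iota _]; rewrite (perm_big _ w_iota).
suff h m : (2 * \sum_(1 <= x < m.+1) x = m * m.+1)%N by rewrite -h /index_iota subSS subn0.
elim: m => [|m IHm]; first by rewrite big_nil.
by rewrite big_nat_recr //= mulnDr IHm -mulnDl addn2 mulnC.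
Qed.

Lemma wordsum_cells_total :
  (wordsum (cells 1) w + wordsum (cells 2) w + wordsum (cells 3) w + wordsum (cells 4) w
   = wordsum (fun _ c _ => c) w)%N.
Proof.
rewrite /wordsum !colsumE -!big_split; apply: eq_bigr => i _ /=.
have [c0 lr0] := words_cell_gt0 i.
by rewrite -[RHS](cells_sum (nth 0 (0 :: w) i) _ (nth 0 w i.+1)) cells0.
Qed.

Lemma wordsum_cells_degree :
  (wordsum (cells 1) w + 2 * wordsum (cells 2) w + 3 * wordsum (cells 3) w
     + 4 * wordsum (cells 4) w + 2 * n
   = 2 * wordsum (fun _ c _ => c) w + wordsum contacts w)%N.
Proof.
rewrite -{1}(size_words _ _ w_in) -[X in (_ + 2 * X)%N]card_ord -sum1_card.
rewrite /wordsum !colsumE !big_distrr -!big_split; apply: eq_bigr => i _ /=.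
by have [c0 _] := words_cell_gt0 i; rewrite muln1 cells_degree_sum.
Qed.

End Words.

Lemma wsum_cells d n : (Q d n)%:R = wsum (wordsum (cells d)) n.
Proof. by rewrite QE natr_sum. Qed.

Lemma wsum_const k n : wsum (fun=> k) n = k%:R * catalan n.
Proof. by rewrite -wsum1 /wsum mulr_sumr; apply: eq_bigr => w _; rewrite mulr1. Qed.

Lemma eq_wsum (f g : seq nat -> nat) n :
  (forall w, w \in words n -> f w = g w) -> wsum f n = wsum g n.
Proof. by move=> fg; rewrite /wsum; apply: eq_big_seq => w /fg ->. Qed.

Lemma wsumM k (f : seq nat -> nat) n : wsum (fun w => k * f w)%N n = k%:R * wsum f n.
Proof. by rewrite /wsum mulr_sumr; apply: eq_bigr => w _; rewrite natrM. Qed.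

(** * Linear equations for the degree totals *)

Section DegreeSums.
Variable n : nat.
Hypothesis n2 : (1 < n)%N.
Notation q d := ((Q d n)%:R : rat).
Notation W F := (wsum (wordsum F) n).

Lemma Q1_wsum : q 1 = W peak + W end_min.
Proof.
by rewrite wsum_cells -wsumD; apply: eq_wsum => w /(wordsum_cells1 _ _ n2).
Qed.

(** Adding [W end_min] turns the [no_inner] total into the constant 3 per word. *)
Lemma Q4_wsum : q 4 + n%:R * catalan n + W end_min = W inner + 3 * catalan n.
Proof.
rewrite wsum_cells -!wsum_const -!wsumD; apply: eq_wsum => w w_in.
rewrite (wordsum_cells4 _ _ w_in) -addnA; congr addn.
exact: wordsum_no_inner_end_min n2 w_in.
Qed.

Lemma Q_total : 2 * (q 1 + q 2 + q 3 + q 4) = (n * n.+1)%:R * catalan n.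
Proof.
rewrite !wsum_cells -!wsum_const -!wsumD -wsumM; apply: eq_wsum => w w_in.
by rewrite (wordsum_cells_total _ _ n2 w_in) (wordsum_height _ _ w_in).
Qed.

Lemma Q_degree_total :
  q 1 + 2 * q 2 + 3 * q 3 + 4 * q 4 + (2 * n)%:R * catalan n
  = (n * n.+1)%:R * catalan n + W contacts.
Proof.
rewrite !wsum_cells -!wsum_const -!wsumM -!wsumD; apply: eq_wsum => w w_in.
by rewrite (wordsum_cells_degree _ _ n2 w_in) (wordsum_height _ _ w_in).
Qed.

End DegreeSums.

(** * Coefficient extraction and closed forms *)

Lemma catalan_mul_centralbE n : 2 * (catalan * centralb) n = centralb n.+1.
Proof.
have := congr1 (@^~ n.+1) catalan_mul_centralb.
by rewrite fps_natME -mulrA fpsXMS fpsDE fpsNE subr0.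
Qed.

Theorem theorem8p1 (n : nat) (hn : (2 <= n)%N) :
  let x : rat := n%:R in
  let B : rat := 'C(2 * n, n)%:R in
  [/\ (Q 1 n)%:R = (x + 2) / (2 * (2 * x - 1)) * B,
      (Q 2 n)%:R =
        ((12 * x ^+ 2 + 44 * x - 112) * B + (2 * x ^+ 2 + x - 1) * 4 ^+ n)
        / (16 * (x + 1) * (2 * x - 1)),
      (Q 3 n)%:R =
        ((8 * x ^+ 2 - 96 * x + 88) * B + (6 * x ^+ 2 + 3 * x - 3) * 4 ^+ n)
        / (8 * (x + 1) * (2 * x - 1))
    & (Q 4 n)%:R =
        (4 * x ^+ 3 - 7 * x ^+ 2 + 29 * x - 20) * B
        / (4 * (x + 1) * (2 * x - 1)) - 7 * 4 ^+ (n - 2)].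
Proof.
move=> x B.
have q1E := Q1_wsum _ hn; have q4E := Q4_wsum _ hn.
have totE := Q_total _ hn; have degE := Q_degree_total _ hn.
have x0 : x != 0 by rewrite pnatr_eq0 -lt0n ltnW.
have x1 : x + 1 != 0 by rewrite natr1 pnatr_eq0.
have x2 : 2 * x - 1 != 0.
  by rewrite subr_eq0 -natrM -[1]/(1%:R) eqr_nat; case: (n) hn => // m _; lia.
have xB : x * B = 2 * (2 * x - 1) * centralb n.-1.
  by rewrite /x /B; case: (n) hn => // m _; rewrite centralbS /= -natr1; ring.
have xE : n%:R = x by []; have BE : centralb n = B by [].
(* With [x] and [B] opaque, every coefficient at a nearby index is rewritten as a rational function
   of [x] times [B], ready for [field]. *)
clearbody x B.
have bE : centralb n.-1 = x * B / (2 * (2 * x - 1)) by rewrite xB; field.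
have cE : catalan n = B / (x + 1) by rewrite /catalan -natr1 xE BE.
have cpE : catalan n.-1 = B / (2 * (2 * x - 1)).
  by rewrite /catalan bE prednK ?(ltnW hn) // xE; field; apply/andP.
have bsE : centralb n.+1 = 2 * (2 * x + 1) * B / (x + 1).
  apply: (mulfI x1); rewrite -{1}xE natr1 centralbS xE BE.
  by field.
have pE : 4 ^+ n = 16 * 4 ^+ (n - 2) :> rat.
  by rewrite -{1}(subnK hn) addnC exprD; congr (_ * _).
have pp : 4 ^+ n.-1 = 4 * 4 ^+ (n - 2) :> rat.
  by rewrite -exprS; congr (_ ^+ _); lia.
have X_n : fpsX n = 0 by case: (n) hn => [|[]].
have XM (u : fps) : (fpsX * u) n = u n.-1.
  by case: (n) hn => // m _; rewrite fpsXMS.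
have XXM (u : fps) : (fpsX * (fpsX * u)) n = u (n - 2)%N.
  by case: (n) hn => [|[|m]] // _; rewrite !fpsXMS subSS subSS subn0.
have peakE : wsum (wordsum peak) n = centralb n.-1 by rewrite wsum_peak mulrC XM.
have endE : wsum (wordsum end_min) n = 2 * catalan n.-1.
  by case: (n) hn => // m _; rewrite wsum_end_min.
have conE : wsum (wordsum contacts) n = x * B - 8 * 4 ^+ (n - 2).
  rewrite wsum_contacts !fpsDE fpsNE fps_natME XM fps1E /pow4 pp pE.
  rewrite (_ : n == 0%N = false) ?gtn_eqF ?(ltnW hn) // /euler xE BE.
  rewrite addr0; ring.
(* The factor 4 doubles [wsum_inner] once more, so that [catalan_mul_centralbE] applies to the
   remaining product. *)
have innE : 4 * wsum (wordsum inner) n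
    = 2 * x * B - 28 * 4 ^+ (n - 2) + 4 * B - centralb n.+1 + 2 * catalan n
      - 2 * centralb n.-1.
  have := congr1 (@^~ n) wsum_inner; rewrite !(fpsDE, fpsNE) !fps_natME XXM !XM X_n.
  rewrite /pow4 pp pE /euler xE BE -catalan_mul_centralbE => e.
  by transitivity (2 * (2 * wsum (wordsum inner) n)); [|rewrite e]; ring.
rewrite peakE endE in q1E.
rewrite natrM -[n.+1%:R]natr1 xE in totE.
rewrite !natrM -[n.+1%:R]natr1 xE conE in degE.
rewrite xE in q4E.
have {}q1E : (Q 1 n)%:R = (x + 2) / (2 * (2 * x - 1)) * B.
  by rewrite q1E bE cpE; field.
have {}q4E : (Q 4 n)%:R = (4 * x ^+ 3 - 7 * x ^+ 2 + 29 * x - 20) * B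
        / (4 * (x + 1) * (2 * x - 1)) - 7 * 4 ^+ (n - 2).
  have -> : (Q 4 n)%:R = (4 * wsum (wordsum inner) n) / 4 + 3 * catalan n
      - x * catalan n - wsum (wordsum end_min) n.
    by rewrite [4 * _]mulrC mulfK // -q4E; ring.
  by rewrite innE endE cpE bsE bE cE; field; apply/andP.
(* The degree total minus twice the vertex total eliminates degree 2. *)
have q3E : (Q 3 n)%:R = (x * (x + 1) * catalan n + (x * B - 8 * 4 ^+ (n - 2)))
    - 2 * x * catalan n - x * (x + 1) * catalan n + (Q 1 n)%:R - 2 * (Q 4 n)%:R.
  by rewrite -degE -totE; ring.
have q2E : (Q 2 n)%:R = x * (x + 1) * catalan n / 2
    - (Q 1 n)%:R - (Q 3 n)%:R - (Q 4 n)%:R.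
  by rewrite -totE; field.
split => //; last 1 first.
- by rewrite q3E q1E q4E cE pE; field; apply/andP.
by rewrite q2E q3E q1E q4E cE pE; field; apply/andP.
Qed.
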